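(* Let $n\geq 2$ be a natural number. Then there exists a common meadow of order $n+1$, i.e. a common meadow with exactly $n+1$ elements.
   Context: A pre-meadow is a structure $(P,+,-,\cdot)$ with two binary operations $+,\cdot$, a unary operation $-$ and constants $0,1$, satisfying for all $x,y,z\in P$: $(x+y)+z=x+(y+z)$; $x+y=y+x$; $x+0=x$; $x+(-x)=0\cdot x$; $(x\cdot y)\cdot z=x\cdot(y\cdot z)$; $x\cdot y=y\cdot x$; $1\cdot x=x$; $x\cdot(y+z)=x\cdot y+x\cdot z$; $-(-x)=x$; $0\cdot(x+y)=0\cdot x+0\cdot y$. For a pre-meadow $P$, let $0\cdot P=\{0\cdot x\mid x\in P\}$ and, for $z\in 0\cdot P$, let $P_z=\{x\in P\mid 0\cdot x=z\}$. $P$ is a pre-meadow with $\mathbf{a}$ if there exists a unique $z\in 0\cdot P$ with $|P_z|=1$, this $z$ being denoted $\mathbf{a}$, and moreover $x+\mathbf{a}=\mathbf{a}$ for all $x\in P$. A common meadow is a pre-meadow with $\mathbf{a}$, $M$, equipped with a (total) inverse function $(\cdot)^{-1}:M\to M$ such that for all $x,y\in M$: $x\cdot x^{-1}=1+0\cdot x^{-1}$; $(x\cdot y)^{-1}=x^{-1}\cdot y^{-1}$; $(1+0\cdot x)^{-1}=1+0\cdot x$; $0^{-1}=\mathbf{a}$. *)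

(* Defs.v *)
From HB Require Import structures.
From mathcomp Require Import all_boot.

Set Implicit Arguments.
Unset Strict Implicit.
Unset Printing Implicit Defensive.

Declare Scope meadow_scope.
Delimit Scope meadow_scope with M.
Local Open Scope meadow_scope.

HB.mixin Record isPreMeadow P := {
  pm_zero : P;
  pm_one : P;
  pm_add : P -> P -> P;
  pm_opp : P -> P;
  pm_mul : P -> P -> P;
  pm_addA : forall x y z, pm_add (pm_add x y) z = pm_add x (pm_add y z);
  pm_addC : forall x y, pm_add x y = pm_add y x;
  pm_addx0 : forall x, pm_add x pm_zero = x;
  pm_addxN : forall x, pm_add x (pm_opp x) = pm_mul pm_zero x;
  pm_mulA : forall x y z, pm_mul (pm_mul x y) z = pm_mul x (pm_mul y z);
  pm_mulC : forall x y, pm_mul x y = pm_mul y x;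
  pm_mul1x : forall x, pm_mul pm_one x = x;
  pm_mulDr : forall x y z,
    pm_mul x (pm_add y z) = pm_add (pm_mul x y) (pm_mul x z);
  pm_oppK : forall x, pm_opp (pm_opp x) = x;
  pm_mul0D : forall x y,
    pm_mul pm_zero (pm_add x y) = pm_add (pm_mul pm_zero x) (pm_mul pm_zero y)
}.

#[short(type="preMeadowType")]
HB.structure Definition PreMeadow := { P of isPreMeadow P }.

Notation "0" := pm_zero : meadow_scope.
Notation "1" := pm_one : meadow_scope.
Notation "x + y" := (pm_add x y) : meadow_scope.
Notation "- x" := (pm_opp x) : meadow_scope.
Notation "x * y" := (pm_mul x y) : meadow_scope.

Definition zero_image (P : preMeadowType) (z : P) : Prop :=
  exists x : P, z = 0 * x.

Definition fiber (P : preMeadowType) (z x : P) : Prop := 0 * x = z.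

(* [z \in 0 . P] and [|P_z| = 1] *)
Definition singleton_fiber (P : preMeadowType) (z : P) : Prop :=
  zero_image z /\ exists! x : P, fiber z x.

HB.mixin Record PreMeadow_hasA P of PreMeadow P := {
  pm_a : P;
  (* [unique Q a] means [Q a] and [a = z] for every [z] with [Q z] *)
  pm_aP : unique (@singleton_fiber P) pm_a;
  pm_addxa : forall x : P, x + pm_a = pm_a
}.

#[short(type="preMeadowWithAType")]
HB.structure Definition PreMeadowWithA :=
  { P of PreMeadow P & PreMeadow_hasA P }.

HB.mixin Record PreMeadowWithA_isCommonMeadow M of PreMeadowWithA M := {
  cm_inv : M -> M;
  cm_mulxV : forall x : M, x * cm_inv x = 1 + 0 * cm_inv x;
  cm_invM : forall x y : M, cm_inv (x * y) = cm_inv x * cm_inv y;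
  cm_inv1D0 : forall x : M, cm_inv (1 + 0 * x) = 1 + 0 * x;
  cm_inv0 : cm_inv 0 = pm_a
}.

#[short(type="commonMeadowType")]
HB.structure Definition CommonMeadow :=
  { M of PreMeadowWithA M & PreMeadowWithA_isCommonMeadow M }.

#[short(type="finCommonMeadowType")]
HB.structure Definition FinCommonMeadow := { M of Finite M & CommonMeadow M }.

(* Main.v *)
Require Import Defs.
From HB Require Import structures.
From mathcomp Require Import all_boot.
From mathcomp Require Import order ssralg finalg zmodp.

(** A common meadow is glued from rings, its nonempty fibres [P_z], indexed by
    the semilattice [0 . P]; the one-element fibre [{a}] absorbs everything and
    receives the inverses that do not exist elsewhere.  Fibres are linked by
    unital ring morphisms, so fields of different characteristics cannot occur
    along one chain, and [n] cannot be split into arbitrary field orders.  A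
    single characteristic is enough: let [p] be a prime divisor of [n], so
    that [n = k * p] with [k > 0], and take [k] copies of the field ['F_p],
    stacked along a chain and linked by identity maps, plus the point [a].
    This has [k * p + 1 = n + 1] elements.

    Copies of a field [F] may be indexed by any finite lattice [L] with a bottom:
    an element is a pair [(i, x)], two pairs are combined in the copy at the join
    of their indices, and [0] and [1] live in the copy at the bottom.  Then
    [0 * (i, x) = (i, 0)], so the fibres other than [{a}] are exact copies of
    [F], which have at least two elements because [0 != 1] in [F]; this makes
    [a] the unique point with a singleton fibre.  Idempotence of the join is what
    distributivity requires, and the absence of zero divisors in [F] is what
    makes the inverse, sending each [(i, 0)] to [a], multiplicative. *)

Set Implicit Arguments.
Unset Strict Implicit.
Unset Printing Implicit Defensive.

Import Order.Theory GRing.Theory.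

(** [None] is the absorbing point [a]. *)
Definition stack (d : Order.disp_t) (L : finTBLatticeType d)
  (F : finFieldType) : Type := option (L * F).

HB.instance Definition _ (d : Order.disp_t) (L : finTBLatticeType d)
  (F : finFieldType) := Finite.on (stack L F).

Definition stack_op (d : Order.disp_t) (L : finTBLatticeType d)
    (F : finFieldType) (op : F -> F -> F) (u v : stack L F) : stack L F :=
  match u, v with
  | Some (i, x), Some (j, y) => Some (Order.join i j, op x y)
  | _, _ => None
  end.

Definition stack_opp (d : Order.disp_t) (L : finTBLatticeType d)
    (F : finFieldType) (u : stack L F) : stack L F :=
  if u is Some (i, x) then Some (i, - x)%R else None.

Definition stack_inv (d : Order.disp_t) (L : finTBLatticeType d)
    (F : finFieldType) (u : stack L F) : stack L F :=
  if u is Some (i, x) then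
    if x == 0%R then None else Some (i, x^-1)%R
  else None.

Definition stack_const (d : Order.disp_t) (L : finTBLatticeType d)
  (F : finFieldType) (x : F) : stack L F := Some (Order.bottom, x).

Lemma stack_opA (d : Order.disp_t) (L : finTBLatticeType d)
    (F : finFieldType) (op : F -> F -> F) (u v w : stack L F) :
  associative op ->
  stack_op op (stack_op op u v) w = stack_op op u (stack_op op v w).
Proof.
by move=> opA; case: u v w => [[i x]|] [[j y]|] [[k z]|] //=; rewrite joinA opA.
Qed.

Lemma stack_opC (d : Order.disp_t) (L : finTBLatticeType d)
    (F : finFieldType) (op : F -> F -> F) (u v : stack L F) :
  commutative op -> stack_op op u v = stack_op op v u.
Proof.
by move=> opC; case: u v => [[i x]|] [[j y]|] //=; rewrite joinC opC.
Qed.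

Lemma stack_op1x (d : Order.disp_t) (L : finTBLatticeType d)
    (F : finFieldType) (op : F -> F -> F) (e : F) (u : stack L F) :
  left_id e op -> stack_op op (stack_const L e) u = u.
Proof. by move=> op1x; case: u => [[i x]|] //=; rewrite join0x op1x. Qed.

Lemma stack_addx0 (d : Order.disp_t) (L : finTBLatticeType d)
    (F : finFieldType) (u : stack L F) :
  stack_op +%R u (stack_const L 0%R) = u.
Proof. by rewrite (stack_opC _ _ (@addrC F)) (stack_op1x _ (@add0r F)). Qed.

Lemma stack_mul0x (d : Order.disp_t) (L : finTBLatticeType d)
    (F : finFieldType) (i : L) (x : F) :
  stack_op *%R (stack_const L 0%R) (Some (i, x)) = Some (i, 0%R).
Proof. by rewrite /= join0x mul0r. Qed.

Lemma stack_addxN (d : Order.disp_t) (L : finTBLatticeType d)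
    (F : finFieldType) (u : stack L F) :
  stack_op +%R u (stack_opp u) = stack_op *%R (stack_const L 0%R) u.
Proof. by case: u => [[i x]|] //; rewrite stack_mul0x /= joinxx subrr. Qed.

Lemma stack_mulDr (d : Order.disp_t) (L : finTBLatticeType d)
    (F : finFieldType) (u v w : stack L F) :
  stack_op *%R u (stack_op +%R v w) =
  stack_op +%R (stack_op *%R u v) (stack_op *%R u w).
Proof.
case: u v w => [[i x]|] [[j y]|] [[k z]|] //=.
by rewrite joinACA joinxx mulrDr.
Qed.

Lemma stack_oppK (d : Order.disp_t) (L : finTBLatticeType d)
    (F : finFieldType) (u : stack L F) : stack_opp (stack_opp u) = u.
Proof. by case: u => [[i x]|] //=; rewrite opprK. Qed.

HB.instance Definition _ (d : Order.disp_t) (L : finTBLatticeType d)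
    (F : finFieldType) :=
  isPreMeadow.Build (stack L F)
    (fun u v w => stack_opA u v w (@addrA F))
    (fun u v => stack_opC u v (@addrC F))
    (@stack_addx0 d L F) (@stack_addxN d L F)
    (fun u v w => stack_opA u v w (@mulrA F))
    (fun u v => stack_opC u v (@mulrC F))
    (fun u => stack_op1x u (@mul1r F))
    (@stack_mulDr d L F) (@stack_oppK d L F)
    (fun u v => stack_mulDr (stack_const L 0%R) u v).

(** The fibre at [(i, 0)] contains both [(i, 0)] and [(i, 1)], whereas only [a]
    lies over [a]. *)
Lemma stack_aP (d : Order.disp_t) (L : finTBLatticeType d)
    (F : finFieldType) : unique (@singleton_fiber (stack L F)) None.
Proof.
split.
  split; first by exists None.
  by exists None; split=> // -[[]|].
move=> z [[u ->]]; case: u => [[i x]|] // [w [_ w_uniq]].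
have w0 : w = Some (i, 0%R).
  by apply: w_uniq; apply: etrans (stack_mul0x i _) (esym (stack_mul0x i _)).
have w1 : w = Some (i, 1%R).
  by apply: w_uniq; apply: etrans (stack_mul0x i _) (esym (stack_mul0x i _)).
have /eqP := oner_neq0 F; case.
by have := etrans (esym w1) w0; case.
Qed.

Lemma stack_addxa (d : Order.disp_t) (L : finTBLatticeType d)
    (F : finFieldType) (u : stack L F) : stack_op +%R u None = None.
Proof. by case: u => [[]|]. Qed.

HB.instance Definition _ (d : Order.disp_t) (L : finTBLatticeType d)
    (F : finFieldType) :=
  PreMeadow_hasA.Build (stack L F) (@stack_aP d L F) (@stack_addxa d L F).

Lemma stack_mulxV (d : Order.disp_t) (L : finTBLatticeType d)
    (F : finFieldType) (u : stack L F) :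
  stack_op *%R u (stack_inv u) =
  stack_op +%R (stack_const L 1%R)
    (stack_op *%R (stack_const L 0%R) (stack_inv u)).
Proof.
case: u => [[i x]|] //=; case: eqVneq => //= x0.
by rewrite joinxx !join0x mulfV // mul0r addr0.
Qed.

Lemma stack_invM (d : Order.disp_t) (L : finTBLatticeType d)
    (F : finFieldType) (u v : stack L F) :
  stack_inv (stack_op *%R u v) = stack_op *%R (stack_inv u) (stack_inv v).
Proof.
case: u v => [[i x]|] [[j y]|] //=; last by case: (x == 0%R).
by rewrite mulf_eq0; case: (x == 0%R); case: (y == 0%R); rewrite //= invfM.
Qed.

Lemma stack_inv1D0 (d : Order.disp_t) (L : finTBLatticeType d)
    (F : finFieldType) (u : stack L F) :
  let e := stack_op +%R (stack_const L 1%R)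
             (stack_op *%R (stack_const L 0%R) u) in
  stack_inv e = e.
Proof. by case: u => [[i x]|] //=; rewrite mul0r addr0 oner_eq0 invr1. Qed.

Lemma stack_inv0 (d : Order.disp_t) (L : finTBLatticeType d)
    (F : finFieldType) : stack_inv (stack_const L (0%R : F)) = None.
Proof. by rewrite /= eqxx. Qed.

HB.instance Definition _ (d : Order.disp_t) (L : finTBLatticeType d)
    (F : finFieldType) :=
  PreMeadowWithA_isCommonMeadow.Build (stack L F)
    (@stack_mulxV d L F) (@stack_invM d L F) (@stack_inv1D0 d L F)
    (@stack_inv0 d L F).

Lemma card_stack (d : Order.disp_t) (L : finTBLatticeType d)
    (F : finFieldType) : #|{: stack L F}| = (#|L| * #|F|).+1.
Proof. by rewrite card_option card_prod. Qed.

(** Combines the total order of ['I_k.+1] with its bounds [ord0] and [ord_max],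
    so that this chain is recognised as a bounded lattice. *)
HB.instance Definition _ (k : nat) := Order.Total.on 'I_k.+1.

Theorem proposition3p1 (n : nat) (hn : 2 <= n) :
  exists M : finCommonMeadowType, #|M| = n.+1.
Proof.
have p_prime : prime (pdiv n) by rewrite pdiv_prime.
have : 0 < n %/ pdiv n by rewrite divn_gt0 ?prime_gt0 // pdiv_leq // ltnW.
have := divnK (pdiv_dvd n); case: (n %/ pdiv n) => // k kp_n _.
exists (stack 'I_k.+1 'F_(pdiv n)).
by rewrite card_stack card_ord card_Fp // kp_n.
Qed.
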